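(* Let $G_1=(V_1,E_1)$ and $G_2=(V_2,E_2)$ be graphs with disjoint vertex sets and let $v\in V_1$. Then $f(G_1\bullet_v G_2)\leq f(G_1)+f(G_2)$ for each $f\in\{\mathrm{thin},\mathrm{pthin},\mathrm{compthin},\mathrm{comppthin}\}$, and $f(G_1\bullet_v G_2)\leq f'(G_1)+f(G_2)-1$ for each $(f,f')\in\{(\mathrm{thin},\mathrm{indthin}),(\mathrm{indthin},\mathrm{indthin}),(\mathrm{pthin},\mathrm{indpthin}),(\mathrm{indpthin},\mathrm{indpthin})\}$. Moreover, if $G_2$ is complete, then $f(G_1\bullet_v G_2)=f(G_1)$ for each $f\in\{\mathrm{thin},\mathrm{pthin},\mathrm{compthin},\mathrm{comppthin}\}$.
   Context: Graphs are finite, simple, undirected. The lexicographical product of $G_1$ and $G_2$ over $v\in V_1$, $G_1\bullet_v G_2$, is the graph obtained from $G_1$ by replacing $v$ by $G_2$: its vertex set is $V_2\cup (V_1\setminus\{v\})$, and $x,y$ are adjacent iff either $x,y\in V_1\setminus\{v\}$ and $xy\in E_1$, or $x,y\in V_2$ and $xy\in E_2$, or $x\in V_1\setminus\{v\}$, $y\in V_2$ and $xv\in E_1$. For a graph $G=(V,E)$, an ordering $v_1,\dots,v_n$ of $V$ and a partition of $V$ are consistent if for every $r<s<t$, whenever $v_r,v_s$ are in the same class and $v_tv_r\in E$, then $v_tv_s\in E$; strongly consistent if moreover for every $r<s<t$, whenever $v_s,v_t$ are in the same class and $v_tv_r\in E$, then $v_sv_r\in E$. $\mathrm{thin}(G)$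 (resp. $\mathrm{pthin}(G)$) is the minimum number of classes of a partition of $V$ consistent (resp. strongly consistent) with some ordering of $V$. $\mathrm{indthin}$, $\mathrm{indpthin}$ are defined likewise requiring each class to be an independent set, and $\mathrm{compthin}$, $\mathrm{comppthin}$ requiring each class to be a clique. *)

(* Defs.v *)
From mathcomp Require Import all_boot.

Set Implicit Arguments.
Unset Strict Implicit.
Unset Printing Implicit Defensive.

Record sgraph := SGraph {
  vertex :> finType;
  adj : rel vertex;
  adj_sym : symmetric adj;
  adj_irrefl : irreflexive adj }.

Definition complete (G : sgraph) : Prop :=
  forall x y : G, x != y -> adj x y.

Section Lex.
Variables (G1 G2 : sgraph) (v : G1).

(* The sum type makes the two vertex sets disjoint. *)
Definition lex_adj (x y : G2 + {u : G1 | u != v}) : bool :=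
  match x, y with
  | inl a, inl b => adj a b
  | inr a, inr b => adj (val a) (val b)
  | inr a, inl _ => adj (val a) v
  | inl _, inr b => adj (val b) v
  end.

Lemma lex_adj_sym : symmetric lex_adj.
Proof. by case=> a [b|b] //=; apply: adj_sym. Qed.

Lemma lex_adj_irrefl : irreflexive lex_adj.
Proof. by case=> a /=; apply: adj_irrefl. Qed.

Definition lex : sgraph := SGraph lex_adj_sym lex_adj_irrefl.
End Lex.

Section Thinness.
Variable G : sgraph.

Definition independent (A : {set G}) : bool :=
  [forall x in A, forall y in A, ~~ adj x y].

Definition clique (A : {set G}) : bool :=
  [forall x in A, forall y in A, (x != y) ==> adj x y].

Definition same_class (P : {set {set G}}) (x y : G) : bool :=
  [exists A in P, (x \in A) && (y \in A)].

(* An ordering of the vertices is an injective v : {ffun 'I_#|G| -> G}; by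
   cardinality it enumerates all of G. *)
Definition consistent (v : {ffun 'I_#|G| -> G}) (P : {set {set G}}) : bool :=
  [forall r : 'I_#|G|, forall s : 'I_#|G|, forall t : 'I_#|G|,
    [&& r < s, s < t, same_class P (v r) (v s) & adj (v t) (v r)]
    ==> adj (v t) (v s)].

Definition strongly_consistent
    (v : {ffun 'I_#|G| -> G}) (P : {set {set G}}) : bool :=
  consistent v P &&
  [forall r : 'I_#|G|, forall s : 'I_#|G|, forall t : 'I_#|G|,
    [&& r < s, s < t, same_class P (v s) (v t) & adj (v t) (v r)]
    ==> adj (v s) (v r)].

Definition feasible (cons : {ffun 'I_#|G| -> G} -> {set {set G}} -> bool)
    (Q : {set G} -> bool) (k : nat) : bool :=
  [exists v : {ffun 'I_#|G| -> G}, exists P : {set {set G}},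
    [&& injectiveb v, partition P [set: G], [forall A in P, Q A],
        cons v P & #|P| == k]].

Definition singletons : {set {set G}} := [set [set x] | x : G].

Lemma singletons_partition : partition singletons [set: G].
Proof.
apply/and3P; split.
- apply/eqP/setP => x; rewrite inE; apply/bigcupP.
  by exists [set x]; rewrite ?inE //; apply/imsetP; exists x.
- apply/trivIsetP => _ _ /imsetP[x _ ->] /imsetP[y _ ->] xy.
  by rewrite disjoints1 inE; apply: contra xy => /eqP->.
- by apply/imsetP => -[x _] /setP/(_ x); rewrite !inE eqxx.
Qed.

Lemma same_class_singletons x y : same_class singletons x y -> x = y.
Proof.
by case/existsP => A /andP[/imsetP[z _ ->]]; rewrite !inE => /andP[/eqP-> /eqP->].
Qed.

Lemma consistent_singletons (v : {ffun 'I_#|G| -> G}) :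
  injective v -> consistent v singletons.
Proof.
move=> vI; apply/forallP => r; apply/forallP => s; apply/forallP => t.
apply/implyP => /and4P[rs _ /same_class_singletons/vI E _].
by move: rs; rewrite E ltnn.
Qed.

Lemma strongly_consistent_singletons (v : {ffun 'I_#|G| -> G}) :
  injective v -> strongly_consistent v singletons.
Proof.
move=> vI; rewrite /strongly_consistent consistent_singletons //=.
apply/forallP => r; apply/forallP => s; apply/forallP => t.
apply/implyP => /and4P[_ st /same_class_singletons/vI E _].
by move: st; rewrite E ltnn.
Qed.

Lemma feasible_ex (cons : {ffun 'I_#|G| -> G} -> {set {set G}} -> bool)
    (Q : {set G} -> bool) :
    (forall v : {ffun 'I_#|G| -> G}, injective v -> cons v singletons) ->
    (forall x, Q [set x]) ->
  exists k, feasible cons Q k.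
Proof.
move=> consS Q1; exists #|singletons|; pose v := [ffun i : 'I_#|G| => enum_val i].
have vI : injective v by move=> i j; rewrite !ffunE => /enum_val_inj.
apply/existsP; exists v; apply/existsP; exists singletons.
rewrite singletons_partition consS // eqxx !andbT; apply/andP; split.
  exact/injectiveP.
by apply/forall_inP => _ /imsetP[x _ ->].
Qed.

Lemma independent1 x : independent [set x].
Proof.
apply/forall_inP => y /set1P->; apply/forall_inP => z /set1P->.
by rewrite adj_irrefl.
Qed.

Lemma clique1 x : clique [set x].
Proof.
apply/forall_inP => y /set1P->; apply/forall_inP => z /set1P->.
by rewrite eqxx.
Qed.

Definition thin : nat :=
  ex_minn (feasible_ex consistent_singletons (Q := xpredT) (fun=> isT)).
Definition pthin : nat :=
  ex_minn (feasible_ex strongly_consistent_singletons (Q := xpredT) (fun=> isT)).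
Definition indthin : nat :=
  ex_minn (feasible_ex consistent_singletons independent1).
Definition indpthin : nat :=
  ex_minn (feasible_ex strongly_consistent_singletons independent1).
Definition compthin : nat :=
  ex_minn (feasible_ex consistent_singletons clique1).
Definition comppthin : nat :=
  ex_minn (feasible_ex strongly_consistent_singletons clique1).
End Thinness.

(* Main.v *)
Require Import Defs.
From mathcomp Require Import all_boot.

Set Implicit Arguments.
Unset Strict Implicit.
Unset Printing Implicit Defensive.

(** An ordering and a partition are replaced by an injective rank into [nat]
    and a colouring. To order [lex G2 v], substitute the ordering of [G2] for
    [v] in that of [G1]. A vertex of [G2] then looks like [v] from outside, so
    the only triples that need an argument are those with two vertices in [G2],
    or with two vertices of one colour, exactly one of which is in [G2].
    The colouring keeps the two palettes disjoint (first bound), or gives the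
    class of [v] a colour of [G2] (second bound, harmless as this class is
    independent), or gives all of [G2] the colour of [v] (complete case).
    The converse inequality of the complete case holds because [G1] is an
    induced subgraph of [lex G2 v] and thinness is hereditary. *)

(** * Orderings and partitions as ranks and colourings *)

Section Layout.
Variable G : sgraph.
Implicit Types (b : bool) (q : rel G) (k : nat).

(** The ranks may have gaps, so two of them combine by arithmetic without renumbering. The flag [b]
    adds the second condition of strong consistency, which lets every argument treat both notions at
    once. *)
Definition layered b (T : finType) (f : G -> nat) (c : G -> T) : Prop :=
  [/\ injective f,
      forall x y z, f x < f y -> f y < f z -> c x = c y -> adj z x -> adj z y &
      b -> forall x y z, f x < f y -> f y < f z -> c y = c z ->
        adj z x -> adj y x].

(** Only the colours in use are counted, so [T] may be any convenient palette. The relation [q]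
    expresses independence or completeness of the classes pair by pair. *)
Definition layout b q k : Prop :=
  exists (T : finType) (f : G -> nat) (c : G -> T),
    [/\ layered b f c, forall x y, c x = c y -> q x y & #|c @: [set: G]| <= k].

Definition consb b := if b then @strongly_consistent G else @consistent G.

Lemma consbP b (o : {ffun 'I_#|G| -> G}) P :
  reflect
    ((forall r s t : 'I_#|G|, r < s -> s < t -> same_class P (o r) (o s) ->
        adj (o t) (o r) -> adj (o t) (o s)) /\
     (b -> forall r s t : 'I_#|G|, r < s -> s < t ->
        same_class P (o s) (o t) -> adj (o t) (o r) -> adj (o s) (o r)))
    (consb b o P).
Proof.
have cP : reflect (forall r s t : 'I_#|G|, r < s -> s < t ->
    same_class P (o r) (o s) -> adj (o t) (o r) -> adj (o t) (o s))
    (consistent o P).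
  apply: (iffP idP) => [H r s t rs st rsP tr|H].
    move/forallP/(_ r)/forallP/(_ s)/forallP/(_ t)/implyP: H; apply.
    exact/and4P.
  apply/forallP => r; apply/forallP => s; apply/forallP => t.
  by apply/implyP => /and4P[]; apply: H.
case: b => /=; last by apply: (iffP cP) => [|[]].
apply: (iffP andP) => -[/cP H1 H2]; split => //.
  move=> _ r s t rs st stP tr.
  move/forallP/(_ r)/forallP/(_ s)/forallP/(_ t)/implyP: H2; apply.
  exact/and4P.
apply/forallP => r; apply/forallP => s; apply/forallP => t.
by apply/implyP => /and4P[]; apply: (H2 isT).
Qed.

Lemma layout_leq b q k k' : k <= k' -> layout b q k -> layout b q k'.
Proof.
move=> kk' [T [f [c [fc qc ck]]]]; exists T, f, c; split => //.
exact: leq_trans kk'.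
Qed.

Lemma same_class_pblock (P : {set {set G}}) x y :
  partition P [set: G] -> same_class P x y = (pblock P x == pblock P y).
Proof.
case/and3P => /eqP cP tP _; have xP z : z \in cover P by rewrite cP inE.
rewrite eq_pblock //; apply/existsP/idP => [[A /and3P[AP xA yA]]|yx].
  by rewrite (def_pblock tP AP xA).
by exists (pblock P x); rewrite pblock_mem // mem_pblock xP.
Qed.

Variables (Q : {set G} -> bool) (q : rel G).
Hypothesis Qq : forall A, Q A <-> {in A &, forall x y, q x y}.

Lemma feasible_layout b k : feasible (consb b) Q k -> layout b q k.
Proof.
case/existsP => o /existsP[P /and5P[/injectiveP oI PP QP /consbP[H1 H2] /eqP<-]].
have [|g go og] := inj_card_bij oI; first by rewrite card_ord.
have scE x y : pblock P x = pblock P y -> same_class P x y.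
  by move=> E; rewrite same_class_pblock // E.
have [/eqP cP tP _] := and3P PP.
have xP x : x \in cover P by rewrite cP inE.
(* The rank of a vertex is its position in the ordering, and its colour is its block. *)
exists {set G}, (fun x => g x : nat), (pblock P); split.
- split=> [x y /val_inj/(can_inj og)//|x y z xy yz /scE xyP|].
    by have:= H1 _ _ _ xy yz; rewrite !og; apply.
  move=> bT x y z xy yz /scE yzP.
  by have:= H2 bT _ _ _ xy yz; rewrite !og; apply.
- move=> x y xy; have /forall_inP/(_ (pblock P x)) := QP.
  rewrite pblock_mem // => /(_ isT)/Qq; apply; first by rewrite mem_pblock.
  by rewrite xy mem_pblock.
- apply/subset_leq_card/subsetP => _ /imsetP[x _ ->]; exact: pblock_mem.
Qed.

Lemma layout_feasible b k :
  layout b q k -> exists2 k', k' <= k & feasible (consb b) Q k'.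
Proof.
move=> [T [f [c [[fI H1 H2] qc ck]]]].
(* Counting the vertices of smaller rank removes the gaps: [g] takes values in ['I_#|G|] and induces
   the same order as [f]. *)
pose down x := [set y | f y < f x].
have down_lt x : #|down x| < #|G|.
  rewrite -cardsT; apply/proper_card/properP; split; first exact: subsetT.
  by exists x; rewrite !inE ?ltnn.
pose g x := Ordinal (down_lt x).
have gf x y : (g x < g y) = (f x < f y).
  case: (ltnP (f x)) => xy; last first.
    apply/negbTE; rewrite -leqNgt; apply/subset_leq_card/subsetP => z.
    by rewrite !inE => /leq_trans; apply.
  apply/proper_card/properP; split.
    by apply/subsetP => z; rewrite !inE => /ltn_trans; apply.
  by exists x; rewrite !inE ?ltnn.
have gI : injective g.
  move=> x y E; apply/fI/eqP; case: ltngtP => //.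
    by rewrite -(gf x y) E ltnn.
  by rewrite -(gf y x) E ltnn.
have [|h hg gh] := inj_card_bij gI; first by rewrite card_ord.
pose P := preim_partition c [set: G].
have PP : partition P [set: G] by apply: preim_partitionP.
have scE x y : same_class P x y -> c x = c y.
  case/existsP => _ /and3P[/imsetP[z _ ->]].
  by rewrite !inE /= => /eqP<- /eqP<-.
have Ef (r s : 'I_#|G|) : (r < s) = (f (h r) < f (h s)) by rewrite -(gf (h r)) !gh.
exists #|P|.
  (* Each class is the fibre of a colour in use, so there are no more classes than such colours. *)
  apply: leq_trans ck; have -> : P = (fun t => [set y | t == c y]) @: (c @: [set: G]).
    rewrite -imset_comp; apply: eq_imset => x /=; apply/setP => y.
    by rewrite !inE.
  exact: leq_imset_card.
apply/existsP; exists [ffun i => h i]; apply/existsP; exists P.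
apply/and5P; split => //.
- by apply/injectiveP => i j; rewrite !ffunE => /(can_inj gh).
- apply/forall_inP => _ /imsetP[z _ ->]; apply/Qq => x y.
  by rewrite !inE /= => /eqP zx /eqP zy; apply: qc; rewrite -zx.
- apply/consbP; split=> [r s t|bT r s t]; rewrite !ffunE !Ef => rs st /scE.
    exact: H1.
  exact: H2.
Qed.

(** All six parameters are instances of this minimum, so each bound on one of them becomes the
    construction of a layout. *)
Lemma ex_minn_layout b (exk : exists k, feasible (consb b) Q k) k :
  ex_minn exk <= k <-> layout b q k.
Proof.
case: ex_minnP => m mF mmin; split=> [mk|/layout_feasible[k' k'k /mmin mk']].
  exact/(layout_leq mk)/feasible_layout.
exact: leq_trans k'k.
Qed.
End Layout.

(** * The six parameters in terms of layouts *)

Section ThinnessLayout.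
Variable G : sgraph.

Definition anyr : rel G := fun _ _ => true.
Definition indr : rel G := fun x y => ~~ adj x y.
Definition cliquer : rel G := fun x y => (x != y) ==> adj x y.

Lemma independentP A : independent A <-> {in A &, forall x y : G, indr x y}.
Proof.
split=> [/forall_inP H x y xA yA|H]; first exact: (forall_inP (H x xA)).
by apply/forall_inP => x xA; apply/forall_inP => y yA; apply: H.
Qed.

Lemma cliqueP A : clique A <-> {in A &, forall x y : G, cliquer x y}.
Proof.
split=> [/forall_inP H x y xA yA|H]; first exact: (forall_inP (H x xA)).
by apply/forall_inP => x xA; apply/forall_inP => y yA; apply: H.
Qed.

Lemma thinP k : thin G <= k <-> layout false anyr k.
Proof. exact: (@ex_minn_layout G xpredT anyr _ false). Qed.

Lemma pthinP k : pthin G <= k <-> layout true anyr k.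
Proof. exact: (@ex_minn_layout G xpredT anyr _ true). Qed.

Lemma indthinP k : indthin G <= k <-> layout false indr k.
Proof. exact: (ex_minn_layout independentP (b := false)). Qed.

Lemma indpthinP k : indpthin G <= k <-> layout true indr k.
Proof. exact: (ex_minn_layout independentP (b := true)). Qed.

Lemma compthinP k : compthin G <= k <-> layout false cliquer k.
Proof. exact: (ex_minn_layout cliqueP (b := false)). Qed.

Lemma comppthinP k : comppthin G <= k <-> layout true cliquer k.
Proof. exact: (ex_minn_layout cliqueP (b := true)). Qed.
End ThinnessLayout.

(** Rank and colouring pull back along the embedding [h], and the pulled-back colouring uses no new
    colour. *)
Lemma layout_induced (G H : sgraph) (h : H -> G) b (qG : rel G) (qH : rel H) k :
    injective h -> (forall x y, adj (h x) (h y) = adj x y) ->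
    (forall x y, qG (h x) (h y) -> qH x y) ->
  layout b qG k -> layout b qH k.
Proof.
move=> hI hA hq [T [f [c [[fI H1 H2] qc ck]]]].
exists T, (f \o h), (c \o h); split=> [|x y /qc/hq//|].
  split=> [|x y z xy yz|bT x y z xy yz]; first exact: inj_comp.
    by rewrite -!hA; apply: H1.
  by rewrite -!hA; apply: H2.
apply: leq_trans ck; apply/subset_leq_card/subsetP => _ /imsetP[x _ ->].
exact: imset_f.
Qed.

(** * Layouts of the lexicographical product *)

Section LexLayout.
Variables (G1 G2 : sgraph) (v : G1).
Notation G := (lex G2 v).

(** This collapses the copy of [G2] back to [v]. *)
Definition lex_proj (a : G) : G1 := if a is inr u then val u else v.

(** A two-digit number in a base exceeding all values of [f2]: the leading digit places the vertex
    in the order of [G1], the trailing one orders the copy of [G2]. Outside the copy the digit [0]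
    is arbitrary, since for injective [f1] no other vertex shares the leading digit. *)
Definition lex_rank (f1 : G1 -> nat) (f2 : G2 -> nat) (a : G) : nat :=
  f1 (lex_proj a) * (\max_x f2 x).+1 + (if a is inl x then f2 x else 0).

Lemma lex_rank_lt f1 f2 (a b : G) :
    injective f1 -> lex_proj a != lex_proj b ->
  (lex_rank f1 f2 a < lex_rank f1 f2 b) = (f1 (lex_proj a) < f1 (lex_proj b)).
Proof.
move=> f1I ab; rewrite /lex_rank; set M := (\max_x f2 x).+1.
have small (d : G) : (if d is inl x then f2 x else 0) < M.
  by case: d => [x|//]; rewrite ltnS; apply: leq_bigmax.
have lt (d e : G) : f1 (lex_proj d) < f1 (lex_proj e) ->
    f1 (lex_proj d) * M + (if d is inl x then f2 x else 0) <
    f1 (lex_proj e) * M + (if e is inl x then f2 x else 0).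
  move=> de; apply: (@leq_trans (f1 (lex_proj e) * M)); last exact: leq_addr.
  apply: (@leq_trans ((f1 (lex_proj d)).+1 * M)); last by rewrite leq_mul2r de orbT.
  by rewrite mulSn addnC ltn_add2r.
have [/lt//|/lt ba|/f1I E] := ltngtP (f1 (lex_proj a)) (f1 (lex_proj b)); last first.
  by rewrite E eqxx in ab.
by apply/negbTE; rewrite -leqNgt ltnW.
Qed.

Lemma lex_rankE f1 f2 (f1I : injective f1) :
  ((forall x y, (lex_rank f1 f2 (inl x) < lex_rank f1 f2 (inl y)) = (f2 x < f2 y)) *
   (forall x u, (lex_rank f1 f2 (inl x) < lex_rank f1 f2 (inr u)) = (f1 v < f1 (val u))) *
   (forall u x, (lex_rank f1 f2 (inr u) < lex_rank f1 f2 (inl x)) = (f1 (val u) < f1 v)) *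
   (forall u w, (lex_rank f1 f2 (inr u) < lex_rank f1 f2 (inr w)) =
      (f1 (val u) < f1 (val w))))%type.
Proof.
split; [split; [split|]|] => [x y|x u|u x|u w].
- by rewrite /lex_rank ltn_add2l.
- by rewrite lex_rank_lt //= eq_sym (valP u).
- by rewrite lex_rank_lt //= (valP u).
- have [->|uw] := eqVneq u w; first by rewrite !ltnn.
  by rewrite lex_rank_lt.
Qed.

Lemma lex_rank_inj f1 f2 :
  injective f1 -> injective f2 -> injective (lex_rank f1 f2).
Proof.
move=> f1I f2I a b E.
have [pab|ab] := eqVneq (lex_proj a) (lex_proj b); last first.
  (* Equal ranks exclude both strict comparisons of the leading digits, so these digits agree and
     injectivity of [f1] applies. *)
  have := lex_rank_lt f2 f1I ab; rewrite E ltnn => /esym/negbT.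
  have := lex_rank_lt f2 f1I (a := b) (b := a).
  rewrite eq_sym E ltnn => /(_ ab)/esym/negbT.
  rewrite -!leqNgt => h1 h2; case/eqP: ab; apply: f1I; apply/eqP.
  by rewrite eqn_leq h1 h2.
move: E; rewrite /lex_rank pab => /addnI.
case: a b pab => [x|u] [y|w] /= => [_ /f2I->//|/esym E|E|/val_inj->//].
  by have := valP w; rewrite /= E eqxx.
by have := valP u; rewrite /= E eqxx.
Qed.

(** The last three hypotheses treat equal colours outside the copy of [G2], inside it, and across
    its border. A triple with at most one vertex in the copy projects to a triple of [G1] with the
    same order and adjacencies, where the conditions on [c1] apply. *)
Lemma lex_layered b (T T1 T2 : finType) f1 f2 (c1 : G1 -> T1) (c2 : G2 -> T2)
    (c : G -> T) :
    layered b f1 c1 -> layered b f2 c2 ->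
    (forall u w, c (inr u) = c (inr w) -> c1 (val u) = c1 (val w)) ->
    (forall x y, c (inl x) = c (inl y) -> c2 x = c2 y \/ complete G2) ->
    (forall u x, c (inr u) = c (inl x) ->
       c1 (val u) = c1 v /\ (~~ adj (val u) v \/ complete G2)) ->
  layered b (lex_rank f1 f2) c.
Proof.
move=> [f1I H1 K1] [f2I H2 K2] cA cB cC.
have rk := lex_rankE f2 f1I; split; first exact: lex_rank_inj.
- move=> [x|u] [y|w] [z|t] /=; rewrite !rk.
  + move=> xy yz /cB[E|cG2] zx; first exact: H2 zx.
    by apply: cG2; apply: contraTneq yz => ->; rewrite ltnn.
  + by [].
  (* The copy of [G2] is an interval of the order, so no outside vertex lies between two of its
     vertices. *)
  + by move=> xw /(ltn_trans xw); rewrite ltnn.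
  + by move=> xw wt /esym/cC[/esym E _] tv; apply: H1 tv.
  (* Two vertices in the copy, one of them coloured like [u]: either [u] is not adjacent to [v] and
     the triple has no edge to start from, or completeness of [G2] supplies the edge. *)
  + move=> _ yz /cC[_ [uv|cG2]]; first by rewrite (negbTE uv).
    by move=> _; apply: cG2; apply: contraTneq yz => ->; rewrite ltnn.
  + by move=> uy yt /cC[E _] tu; apply: H1 tu.
  + move=> uw wz /cA E; rewrite ![adj _ v]adj_sym; exact: H1.
  + by move=> uw wt /cA E; apply: H1.
- move=> bT [x|u] [y|w] [z|t] /=; rewrite !rk.
  + move=> xy yz /cB[E|cG2] zx; first exact: (K2 bT) zx.
    by apply: cG2; apply: contraTneq xy => ->; rewrite ltnn.
  (* The mirror image of the previous border case, with the outside vertex last. *)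
  + move=> xy _ /esym/cC[_ [tv|cG2]]; first by rewrite (negbTE tv).
    by move=> _; apply: cG2; apply: contraTneq xy => ->; rewrite ltnn.
  + by move=> xw /(ltn_trans xw); rewrite ltnn.
  + by move=> xw wt /cA E; apply: K1.
  + by [].
  + move=> uy yt /esym/cC[/esym E _]; rewrite [adj _ v]adj_sym; exact: K1.
  + move=> uw wz /cC[E _]; rewrite [adj _ v]adj_sym; exact: K1.
  + by move=> uw wt /cA E; apply: K1.
Qed.

Lemma card_imset_sum (A T1 T2 : finType) (c : A -> T1 + T2)
    (B1 : {set T1}) (B2 : {set T2}) :
    (forall a, match c a with inl t => t \in B1 | inr t => t \in B2 end) ->
  #|c @: [set: A]| <= #|B1| + #|B2|.
Proof.
move=> cB; rewrite -(card_imset _ (@inl_inj T1 T2)).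
rewrite -(card_imset B2 (@inr_inj T1 T2)).
apply: leq_trans (leq_card_setU _ _); apply/subset_leq_card/subsetP.
move=> _ /imsetP[a _ ->]; rewrite inE; have := cB a.
by case: (c a) => t tB; rewrite (imset_f _ tB) ?orbT.
Qed.

Variables (b : bool) (q1 : rel G1) (q2 : rel G2) (q : rel G) (k1 k2 : nat).

(** The sum type keeps the palettes apart, so no colour is shared across the border of the copy. *)
Lemma lex_layout_disjoint :
    (forall u w, q1 (val u) (val w) -> q (inr u) (inr w)) ->
    (forall x y, q2 x y -> q (inl x) (inl y)) ->
  layout b q1 k1 -> layout b q2 k2 -> layout b q (k1 + k2).
Proof.
move=> qr ql [T1 [f1 [c1 [L1 q1c ck1]]]] [T2 [f2 [c2 [L2 q2c ck2]]]].
pose c (a : G) : T1 + T2 :=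
  match a with inl x => inr (c2 x) | inr u => inl (c1 (val u)) end.
exists (T1 + T2 : finType)%type, (lex_rank f1 f2), c; split.
- by apply: lex_layered L1 L2 _ _ _ => [u w []|x y []|] //; left.
- by case=> [x|u] [y|w] //= []; [move/q2c/ql|move/q1c/qr].
- apply: leq_trans (leq_add ck1 ck2).
  by apply: card_imset_sum => -[x|u] /=; apply: imset_f.
Qed.

(** The class of [v] takes over the colour of some [x0] in [G2]. Its members are not adjacent to
    [v], hence to no vertex of the copy, which settles the border case of [lex_layered] and is what
    [qm] needs. *)
Lemma lex_layout_independent :
    0 < #|G2| ->
    (forall u w, ~~ adj (val u) (val w) -> q (inr u) (inr w)) ->
    (forall x y, q2 x y -> q (inl x) (inl y)) ->
    (forall u x, ~~ adj (val u) v -> q (inr u) (inl x) && q (inl x) (inr u)) ->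
  layout b (@indr G1) k1 -> layout b q2 k2 -> layout b q (k1 + k2 - 1).
Proof.
case/card_gt0P => x0 _ qr ql qm.
move=> [T1 [f1 [c1 [L1 q1c ck1]]]] [T2 [f2 [c2 [L2 q2c ck2]]]].
pose c (a : G) : T1 + T2 :=
  match a with
  | inl x => inr (c2 x)
  | inr u => if c1 (val u) == c1 v then inr (c2 x0) else inl (c1 (val u))
  end.
have cA u w : c (inr u) = c (inr w) -> c1 (val u) = c1 (val w).
  by rewrite /=; case: eqP => [->|_]; case: eqP => [->|_] // [].
have cC u x : c (inr u) = c (inl x) -> c1 (val u) = c1 v by rewrite /=; case: eqP.
exists (T1 + T2 : finType)%type, (lex_rank f1 f2), c; split.
- apply: lex_layered L1 L2 cA _ _ => [x y []|u x /cC E]; first by left.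
  by split=> //; left; apply: q1c.
- case=> [x|u] [y|w].
  + by case=> /q2c/ql.
  + by move=> /esym/cC/q1c/(qm _ x)/andP[].
  + by move=> /cC/q1c/(qm _ y)/andP[].
  + by move=> /cA/q1c/qr.
- have c1v : c1 v \in c1 @: [set: G1] by apply: imset_f.
  (* The subtraction is not truncated: [c1 v] is in use, so [k1] is positive. The saved colour is
     [inl (c1 v)], which [c] never takes. *)
  rewrite leq_subRL; last by move: ck1; rewrite (cardsD1 (c1 v)) c1v; case: (k1).
  apply: leq_trans (leq_add ck1 ck2).
  rewrite (cardsD1 (c1 v)) c1v -addnA leq_add2l.
  apply: card_imset_sum => -[x|u] /=; first exact: imset_f.
  by case: ifP => [_|uv]; rewrite ?in_setD1 ?uv imset_f.
Qed.

(** Colouring through [lex_proj] gives the whole copy the colour of [v]. Inside the copy and across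
    its border, [lex_layered] is then met by its alternative [complete G2]. *)
Lemma lex_layout_complete :
    complete G2 ->
    (forall a d, q1 (lex_proj a) (lex_proj d) -> q a d) ->
  layout b q1 k1 -> layout b q2 k2 -> layout b q k1.
Proof.
move=> cG2 qq [T1 [f1 [c1 [L1 q1c ck1]]]] [T2 [f2 [c2 [L2 _ _]]]].
exists T1, (lex_rank f1 f2), (c1 \o @lex_proj); split=> [|a d /q1c/qq//|].
  by apply: lex_layered L1 L2 _ _ _ => [u w|x y _|u x] //=; [right|split; [|right]].
apply: leq_trans ck1; apply/subset_leq_card/subsetP => _ /imsetP[a _ ->].
exact: imset_f.
Qed.

(** The vertex [x0] stands in for [v], which makes [h] a section of [lex_proj] and embeds [G1] as an
    induced subgraph. *)
Lemma lex_layout_hereditary (x0 : G2) :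
    (forall a d, q a d -> q1 (lex_proj a) (lex_proj d)) ->
  layout b q k1 -> layout b q1 k1.
Proof.
move=> qq; pose h (u : G1) : G := if insub u is Some w then inr w else inl x0.
have hK : cancel h (@lex_proj).
  by move=> u; rewrite /h; case: insubP => [w _ //|] /=; rewrite negbK => /eqP.
apply: (layout_induced (can_inj hK)) => [u w|u w /qq]; last by rewrite !hK.
rewrite -[u in RHS]hK -[w in RHS]hK /h.
case: insubP => [u' _ _|_]; case: insubP => [w' _ _|_] //=; last by rewrite !adj_irrefl.
exact: adj_sym.
Qed.
End LexLayout.

Theorem theorem4p14 (G1 G2 : sgraph) (v : G1) :
  [/\ thin (lex G2 v) <= thin G1 + thin G2,
      pthin (lex G2 v) <= pthin G1 + pthin G2,
      compthin (lex G2 v) <= compthin G1 + compthin G2 &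
      comppthin (lex G2 v) <= comppthin G1 + comppthin G2]
  /\ (0 < #|G2| ->
      [/\ thin (lex G2 v) <= indthin G1 + thin G2 - 1,
          indthin (lex G2 v) <= indthin G1 + indthin G2 - 1,
          pthin (lex G2 v) <= indpthin G1 + pthin G2 - 1 &
          indpthin (lex G2 v) <= indpthin G1 + indpthin G2 - 1])
  /\ (0 < #|G2| -> complete G2 ->
      [/\ thin (lex G2 v) = thin G1,
          pthin (lex G2 v) = pthin G1,
          compthin (lex G2 v) = compthin G1 &
          comppthin (lex G2 v) = comppthin G1]).
Proof.
(* Each parameter is attained by a layout with exactly that many colours allowed. *)
have T1 := (iffLR (thinP _ _) (leqnn (thin G1))).
have T2 := (iffLR (thinP _ _) (leqnn (thin G2))).
have P1 := (iffLR (pthinP _ _) (leqnn (pthin G1))).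
have P2 := (iffLR (pthinP _ _) (leqnn (pthin G2))).
have I1 := (iffLR (indthinP _ _) (leqnn (indthin G1))).
have I2 := (iffLR (indthinP _ _) (leqnn (indthin G2))).
have J1 := (iffLR (indpthinP _ _) (leqnn (indpthin G1))).
have J2 := (iffLR (indpthinP _ _) (leqnn (indpthin G2))).
have C1 := (iffLR (compthinP _ _) (leqnn (compthin G1))).
have C2 := (iffLR (compthinP _ _) (leqnn (compthin G2))).
have D1 := (iffLR (comppthinP _ _) (leqnn (comppthin G1))).
have D2 := (iffLR (comppthinP _ _) (leqnn (comppthin G2))).
split; [|split=> [G2_gt0|G2_gt0 cG2]].
- split.
  + by apply/thinP; apply: lex_layout_disjoint T1 T2.
  + by apply/pthinP; apply: lex_layout_disjoint P1 P2.
  + by apply/compthinP; apply: lex_layout_disjoint C1 C2.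
  + by apply/comppthinP; apply: lex_layout_disjoint D1 D2.
- have ind_mixed (u : {u : G1 | u != v}) (x : G2) : ~~ adj (val u) v ->
      @indr (lex G2 v) (inr u) (inl x) && @indr (lex G2 v) (inl x) (inr u).
    by rewrite /indr /= => ->.
  split.
  + by apply/thinP; apply: lex_layout_independent I1 T2.
  + by apply/indthinP; apply: lex_layout_independent I1 I2.
  + by apply/pthinP; apply: lex_layout_independent J1 P2.
  + by apply/indpthinP; apply: lex_layout_independent J1 J2.
- have /card_gt0P[x0 _] := G2_gt0.
  (* Two vertices of the copy project to the same vertex [v], where the clique relation is trivial;
     completeness of [G2] makes it hold upstairs too. *)
  have cl (a d : lex G2 v) :
      cliquer (lex_proj a) (lex_proj d) = cliquer a d.
    rewrite /cliquer; case: a d => [x|u] [y|w] //=.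
    - rewrite eqxx; apply/esym/implyP => xy; exact: cG2.
    - by rewrite eq_sym (valP w) adj_sym.
    - by rewrite (valP u).
  split; apply/eqP; rewrite eqn_leq; apply/andP; split.
  + by apply/thinP; apply: lex_layout_complete T1 T2.
  + by apply/thinP; apply: (lex_layout_hereditary x0) (iffLR (thinP _ _) (leqnn _)).
  + by apply/pthinP; apply: lex_layout_complete P1 P2.
  + by apply/pthinP; apply: (lex_layout_hereditary x0) (iffLR (pthinP _ _) (leqnn _)).
  + by apply/compthinP; apply: lex_layout_complete C1 C2 => // a d; rewrite cl.
  + apply/compthinP.
    apply: (lex_layout_hereditary x0) (iffLR (compthinP _ _) (leqnn _)) => a d.
    by rewrite cl.
  + by apply/comppthinP; apply: lex_layout_complete D1 D2 => // a d; rewrite cl.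
  + apply/comppthinP.
    apply: (lex_layout_hereditary x0) (iffLR (comppthinP _ _) (leqnn _)) => a d.
    by rewrite cl.
Qed.
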